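(* Let $G$ be a finitely presented amenable group with unsolvable word problem. Then for any choice of generators $W\to G$ the word problem in $G$ is not solvable on any exponentially generic subset of $W$.
   Context: Let $A=\{a_1,\ldots,a_m,a_1^{-1},\ldots,a_m^{-1}\}$ be a finite alphabet with formal inverses, $m\ge 2$. $W$ is the free monoid of all words over $A$; $|w|$ is the length of a word $w$; $W_n=\{w\in W: |w|\le n\}$. A subset $X\subset W$ is exponentially generic if there is $\alpha\in(0,1)$ with $\left|1-\frac{|X\cap W_n|}{|W_n|}\right|\le\alpha^n$ for all sufficiently large $n$. A choice of generators for a group $G$ is a monoid epimorphism $W\to G$ respecting inverses; the image of $w$ is denoted $\overline w$. The word problem for $G$ (with respect to $W\to G$) is to decide for $w\in W$ whether $\overline w=1$ in $G$. The word problem is solvable on a subset $D\subset W$ if there is a partial algorithm, with inputs $w\in W$, which never gives a wrong answer to the question whether $\overline w=1$ and which halts with an answer on every $w\in D$. *)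

(* Defs.v *)
From mathcomp Require Import all_boot all_order all_algebra.
From mathcomp Require Import all_classical all_reals all_analysis.

Set Implicit Arguments.
Unset Strict Implicit.
Unset Printing Implicit Defensive.

Import Order.TTheory GRing.Theory Num.Theory.
Import numFieldNormedType.Exports.

Local Open Scope classical_set_scope.
Local Open Scope ring_scope.

(* The letter (i, false) is a_i and (i, true) is its formal inverse. *)
Notation letter m := ('I_m * bool)%type.

Definition letter_inv m (a : letter m) : letter m := (a.1, ~~ a.2).

(* The free monoid W on the letters: words need not be freely reduced. *)
Definition word (m : nat) : Type := seq (letter m).

Definition word_inv m (w : word m) : word m := rev (map (@letter_inv m) w).

Record choice_of_generators (G : groupType) (m : nat) (phi : word m -> G) :
    Prop := ChoiceOfGenerators {
  gens_nil : phi [::] = 1%g;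
  gens_cat : forall u v : word m, phi (u ++ v) = (phi u * phi v)%g;
  gens_inv : forall a : letter m, phi [:: letter_inv a] = (phi [:: a])^-1%g;
  gens_surj : forall g : G, exists w : word m, phi w = g
}.

(* n.-bseq (letter m) is the finite type of words of length at most n. *)
Definition exponentially_generic (R : realType) (m : nat)
    (X : set (word m)) : Prop :=
  exists2 alpha : R, 0 < alpha < 1 &
    \forall n \near \oo,
      `|1 - #|[pred w : n.-bseq (letter m) | (w : word m) \in X]|%:R
            / #|{: n.-bseq (letter m)}|%:R| <= alpha ^+ n.

(* Words of W whose image in the free group lies in the normal closure of the
   images of the relators. *)
Inductive normal_closure (m : nat) (rels : seq (word m)) : word m -> Prop :=
| NclRel r : r \in rels -> normal_closure rels r
| NclNil : normal_closure rels [::]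
| NclMul u v : normal_closure rels u -> normal_closure rels v ->
    normal_closure rels (u ++ v)
| NclInv u : normal_closure rels u -> normal_closure rels (word_inv u)
| NclConj u v : normal_closure rels u ->
    normal_closure rels (v ++ u ++ word_inv v)
| NclInsert u v a : normal_closure rels (u ++ v) ->
    normal_closure rels (u ++ a :: letter_inv a :: v)
| NclDelete u v a : normal_closure rels (u ++ a :: letter_inv a :: v) ->
    normal_closure rels (u ++ v).

Definition finitely_presented (G : groupType) : Prop :=
  exists (n : nat) (psi : word n -> G) (rels : seq (word n)),
    choice_of_generators psi /\
    forall w : word n, psi w = 1%g <-> normal_closure rels w.

(* Existence of a left-invariant mean on the bounded real functions on G; the
   values of mu at unbounded functions are irrelevant. *)
Definition amenable (R : realType) (G : groupType) : Prop :=
  exists mu : (G -> R) -> R,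
    [/\ forall (c : R) (f g : G -> R), bounded_fun f -> bounded_fun g ->
          mu (fun x => c * f x + g x) = c * mu f + mu g,
        forall f : G -> R, bounded_fun f -> (forall x, 0 <= f x) -> 0 <= mu f,
        mu (fun=> 1) = 1
      & forall (a : G) (f : G -> R), bounded_fun f ->
          mu (fun x => f (a * x)%g) = mu f].

(* Codes of partial recursive functions of n natural numbers. *)
Inductive recfun : nat -> Type :=
| RZero n : recfun n
| RSucc : recfun 1
| RProj n (i : 'I_n) : recfun n
| RComp k n (f : recfun k) (g : 'I_k -> recfun n) : recfun n
| RPrec n (f : recfun n) (g : recfun n.+2) : recfun n.+1
| RMu n (f : recfun n.+1) : recfun n.

(* computes f v y: the partial function f is defined at v, with value y.
   Recursion is on the first argument, and g receives the counter, then the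
   value at the counter, then the parameters. *)
Fixpoint computes n (f : recfun n) : n.-tuple nat -> nat -> Prop :=
  match f in recfun n return n.-tuple nat -> nat -> Prop with
  | RZero _ => fun _ y => y = 0%N
  | RSucc => fun v y => y = (thead v).+1
  | RProj _ i => fun v y => y = tnth v i
  | RComp k _ f g => fun v y =>
      exists2 u : k.-tuple nat,
        forall i, computes (g i) v (tnth u i) & computes f u y
  | RPrec n f g => fun v =>
      let p : n.-tuple nat := behead_tuple v in
      (fix iterate (t y : nat) : Prop :=
         match t with
         | 0%N => computes f p y
         | t'.+1 => exists2 z, iterate t' z &
             computes g (cons_tuple t' (cons_tuple z p)) y
         end) (thead v)
  | RMu _ f => fun v y =>
      computes f (cons_tuple y v) 0%N /\
      forall z, (z < y)%N -> exists k, computes f (cons_tuple z v) k.+1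
  end.

(* Words are coded by numbers in bijective base 2m, first letter as the least
   significant digit. *)
Definition letter_code m (a : letter m) : nat := (a.1.*2 + a.2)%N.

Definition word_code m (w : word m) : nat :=
  foldr (fun a c => (letter_code a + m.*2 * c).+1) 0%N w.

Lemma word_code_inj m : injective (@word_code m).
Proof.
have lt_code (a : letter m) : (letter_code a < m.*2)%N.
  case: a => i []; rewrite /letter_code /= ?addn0 ?addn1 ?ltn_double //.
  by rewrite -doubleS ltn_Sdouble.
elim=> [|a u IHu] [|b v] //= [] e.
have /(f_equal (modn^~ m.*2)) := e; have := f_equal (divn^~ m.*2) e.
have m2 : (0 < m.*2)%N by exact: leq_ltn_trans (lt_code a).
rewrite -!(mulnC (word_code _)) !(divnMDl, modnMDl, addnC (letter_code _)) //.
rewrite !divn_small // !addn0 !modn_small // => /IHu <- eab.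
congr (_ :: _); case: a b eab {e lt_code} => i c [j d]; rewrite /letter_code /=.
move=> e; have ecd : c = d.
  by move: (f_equal odd e); rewrite !oddD !odd_double; case: c d {e} => [] [].
by move: e; rewrite ecd => /addIn /double_inj /val_inj ->.
Qed.

(* Existence of a partial algorithm that is correct whenever it halts and halts
   on all of D; output 0 means "nontrivial", any other output "trivial". *)
Definition word_problem_solvable_on (G : groupType) (m : nat)
    (phi : word m -> G) (D : set (word m)) : Prop :=
  exists f : recfun 1,
    (forall (w : word m) (y : nat),
        computes f [tuple word_code w] y -> (y <> 0%N <-> phi w = 1%g)) /\
    (forall w : word m, D w -> exists y, computes f [tuple word_code w] y).

(* Solvability does not depend on the choice of generators, so a single choice
   with unsolvable word problem is the weakest form of the hypothesis. *)
Definition unsolvable_word_problem (G : groupType) : Prop :=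
  exists (n : nat) (psi : word n -> G),
    choice_of_generators psi /\ ~ word_problem_solvable_on psi setT.

(* Main.v *)
Require Import Defs.
From mathcomp Require Import all_boot all_order all_algebra.
From mathcomp Require Import all_classical all_reals all_analysis.
From mathcomp Require Import zify ring lra.

(* Every word w has the same image as some word of D. Otherwise D misses all
   words wu with u trivial, so the number t_k of trivial words of length k is
   at most C (2 alpha m)^k with alpha < 1. Then for some z > 1/(2m) the Green
   function h(g) = sum_k z^k #{u : |u| = k, u = g} is finite, positive, and
   satisfies sum_a h(a^-1 g) <= h(g) / z. The functions
   d_a(g) = ln h(a^-1 g) - ln h(g) are bounded, and ln t <= t - 1 gives
   sum_a d_a <= 1/z - 2m < 0. But an invariant mean gives d_a and d_(a^-1)
   opposite values, hence the value 0 to the sum: a contradiction.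

   As G is finitely presented, the words equal to w can be enumerated by
   applying finitely many rewriting rules. Running the partial algorithm in
   parallel on all of them, one reaches an element of D, so some run halts, and
   every answer obtained is correct for w. This solves the word problem. *)

Set Implicit Arguments.
Unset Strict Implicit.
Unset Printing Implicit Defensive.

Local Open Scope nat_scope.

(** * Recursive functions *)

(** One equivalence says that the code is total, correct and single-valued. Arguments come as plain
    lists, so that functions compose without dependent types; the values at lists of length other
    than [n] are irrelevant. *)
Definition recursive n (e : seq nat -> nat) : Prop :=
  exists f : recfun n, forall (v : n.-tuple nat) y,
    computes f v y <-> y = e v.

Lemma recursive_ext n (e e' : seq nat -> nat) :
  (forall v, size v = n -> e v = e' v) -> recursive n e -> recursive n e'.
Proof.
move=> ee' [f fP]; exists f => v y; rewrite fP ee' //; exact: size_tuple.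
Qed.

Lemma recursive_nth n i : i < n -> recursive n (fun v => nth 0 v i).
Proof.
move=> lt_in; exists (RProj (Ordinal lt_in)) => v y /=.
by rewrite (tnth_nth 0).
Qed.

Lemma recursive_comp n (e : seq nat -> nat) (hs : seq (seq nat -> nat)) :
  recursive (size hs) e ->
  (forall i, i < size hs -> recursive n (nth (fun=> 0) hs i)) ->
  recursive n (fun v => e [seq h v | h <- hs]).
Proof.
move=> [f fP] hsP.
have [g gP] := choice (fun i : 'I_(size hs) => hsP i (ltn_ord i)).
exists (RComp f g) => v y /=; split=> [[u uP /fP ->]|->].
  congr e; apply: (@eq_from_nth _ 0); first by rewrite size_tuple size_map.
  move=> i; rewrite size_tuple => lt_i.
  have /gP := uP (Ordinal lt_i).
  by rewrite (tnth_nth 0) /= => ->; rewrite (nth_map (fun=> 0)).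
have sz : size [seq h (v : seq nat) | h <- hs] == size hs by rewrite size_map.
exists (Tuple sz) => [i|]; last exact/fP.
by apply/gP; rewrite (tnth_nth 0) /= (nth_map (fun=> 0)).
Qed.

Lemma recursive_comp1 n (h : nat -> nat) e :
  recursive 1 (fun v => h (nth 0 v 0)) -> recursive n e ->
  recursive n (fun v => h (e v)).
Proof.
by move=> hP eP; apply: (@recursive_comp n _ [:: e]) hP _ => -[].
Qed.

Lemma recursive_comp2 n (h : nat -> nat -> nat) e1 e2 :
  recursive 2 (fun v => h (nth 0 v 0) (nth 0 v 1)) ->
  recursive n e1 -> recursive n e2 ->
  recursive n (fun v => h (e1 v) (e2 v)).
Proof.
by move=> hP e1P e2P; apply: (@recursive_comp n _ [:: e1; e2]) hP _ => -[|[]].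
Qed.

(** Composition that changes the leading arguments and passes the remaining ones on: the tail is
    supplied by projections appended to [hs]. *)
Lemma recursive_comp_drop n k (e : seq nat -> nat) hs :
  recursive (size hs + n) e ->
  (forall i, i < size hs -> recursive (k + n) (nth (fun=> 0) hs i)) ->
  recursive (k + n) (fun v => e ([seq h v | h <- hs] ++ drop k v)).
Proof.
move=> eP hsP.
pose ps := [seq (fun v : seq nat => nth 0 v (k + i)) | i <- iota 0 n].
have szps : size ps = n by rewrite size_map size_iota.
apply: (@recursive_ext _ (fun v => e [seq h v | h <- hs ++ ps])) => [v szv|].
  congr e; rewrite map_cat; congr (_ ++ _); apply: (@eq_from_nth _ 0).
    by rewrite size_drop szv size_map szps addKn.
  move=> i; rewrite size_map szps => lt_in.
  rewrite (nth_map (fun=> 0)) ?szps // (nth_map 0) ?size_iota //.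
  by rewrite nth_iota // nth_drop.
apply: recursive_comp; rewrite size_cat szps // => i lt_i.
rewrite nth_cat; case: ltnP => [/hsP //|le_i].
rewrite (nth_map 0) ?size_iota ?nth_iota ?ltn_subLR //.
by apply: recursive_nth; rewrite ltn_add2l ltn_subLR.
Qed.

Lemma recursive_behead2 n e :
  recursive n e -> recursive n.+2 (fun v => e (behead (behead v))).
Proof.
move=> eP; apply: recursive_ext (@recursive_comp_drop n 2 e [::] eP _) => // v _.
by rewrite -!drop1 drop_drop.
Qed.

Lemma recursive0 n : recursive n (fun=> 0).
Proof. by exists (RZero n). Qed.

Lemma recursiveS n e : recursive n e -> recursive n (fun v => (e v).+1).
Proof.
apply: recursive_comp1; exists RSucc => v y /=.
by case/tupleP: v => x v; rewrite theadE.
Qed.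

Lemma recursive_const n c : recursive n (fun=> c).
Proof. by elim: c => [|c IHc]; [exact: recursive0|exact: recursiveS IHc]. Qed.

(** Primitive recursion in the shape of an iteration with parameters, on which the arithmetic below
    rests. The argument order of the step (counter, value, parameters) is that of [RPrec]. *)
Lemma recursive_iteri n (F : nat -> nat -> seq nat -> nat) et e0 :
  recursive n et -> recursive n e0 ->
  recursive n.+2 (fun s => F (nth 0 s 0) (nth 0 s 1) (behead (behead s))) ->
  recursive n (fun v => iteri (et v) (fun k z => F k z v) (e0 v)).
Proof.
move=> etP [f0 f0P] [f1 f1P].
have precP : recursive n.+1 (fun s => iteri (nth 0 s 0)
    (fun k z => F k z (behead s)) (e0 (behead s))).
  exists (RPrec f0 f1); case/tupleP=> t p y /=; rewrite theadE.
  have -> : behead_tuple (cons_tuple t p) = p by exact: val_inj.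
  elim: t y => [|t IHt] y /=; first exact: f0P.
  split=> [[z /IHt -> /f1P //]|->].
  by exists (iteri t (fun k z => F k z p) (e0 p)); [exact/IHt|exact/f1P].
have := @recursive_comp_drop n 0 _ [:: et] precP; rewrite add0n.
have hsP i : i < 1 -> recursive n (nth (fun=> 0) [:: et] i) by case: i.
by move=> /(_ hsP); apply: recursive_ext => v _; rewrite drop0.
Qed.

Lemma recursive_nth_behead2 n i : i < n ->
  recursive n.+2 (fun v => nth 0 (behead (behead v)) i).
Proof.
move=> lt_in.
exact: (@recursive_behead2 _ (fun v => nth 0 v i) (recursive_nth lt_in)).
Qed.

Lemma recursiveD n e1 e2 : recursive n e1 -> recursive n e2 ->
  recursive n (fun v => e1 v + e2 v).
Proof.
apply: recursive_comp2.
apply: (@recursive_ext _ (fun v => iteri (nth 0 v 0) (fun _ z => z.+1) (nth 0 v 1))).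
  by move=> v _; elim: (nth 0 v 0) => //= k ->.
apply: (@recursive_iteri _ (fun _ z _ => z.+1)); [exact: recursive_nth..|].
exact/recursiveS/recursive_nth.
Qed.

Lemma recursiveM n e1 e2 : recursive n e1 -> recursive n e2 ->
  recursive n (fun v => e1 v * e2 v).
Proof.
apply: recursive_comp2.
apply: (@recursive_ext _ (fun v =>
    iteri (nth 0 v 0) (fun _ z => nth 0 v 1 + z) 0)).
  by move=> v _; elim: (nth 0 v 0) => //= k ->; rewrite mulSn.
apply: (@recursive_iteri _ (fun _ z v => nth 0 v 1 + z)).
- exact: recursive_nth.
- exact: recursive0.
by apply: recursiveD; [exact: recursive_nth_behead2|exact: recursive_nth].
Qed.

Lemma recursive_pred n e : recursive n e -> recursive n (fun v => (e v).-1).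
Proof.
apply: recursive_comp1.
apply: (@recursive_ext _ (fun v => iteri (nth 0 v 0) (fun k _ => k) 0)).
  by move=> v _; case: (nth 0 v 0).
by apply: (@recursive_iteri _ (fun k _ _ => k));
  [exact: recursive_nth|exact: recursive0|exact: recursive_nth].
Qed.

Lemma recursiveB n e1 e2 : recursive n e1 -> recursive n e2 ->
  recursive n (fun v => e1 v - e2 v).
Proof.
apply: recursive_comp2.
apply: (@recursive_ext _ (fun v =>
    iteri (nth 0 v 1) (fun _ z => z.-1) (nth 0 v 0))).
  move=> v _; elim: (nth 0 v 1) => [|k /= ->]; first by rewrite subn0.
  by rewrite subnS.
apply: (@recursive_iteri _ (fun _ z _ => z.-1)); [exact: recursive_nth..|].
exact/recursive_pred/recursive_nth.
Qed.

Lemma recursive_if n b e1 e2 :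
  recursive n (fun v => nat_of_bool (b v)) -> recursive n e1 ->
  recursive n e2 -> recursive n (fun v => if b v then e1 v else e2 v).
Proof.
move=> bP e1P e2P; apply: (@recursive_ext _
    (fun v => b v * e1 v + (1 - b v) * e2 v)) => [v _|].
  by case: (b v); rewrite /= ?subnn ?subn0 !(mul1n, mul0n, addn0, add0n).
by apply: recursiveD; apply: recursiveM => //; apply: recursiveB => //;
  exact: recursive_const.
Qed.

Lemma recursive_leq n e1 e2 : recursive n e1 -> recursive n e2 ->
  recursive n (fun v => nat_of_bool (e1 v <= e2 v)).
Proof.
move=> e1P e2P; apply: (@recursive_ext _ (fun v => 1 - (e1 v - e2 v))).
  by move=> v _; rewrite -subn_eq0; case: (e1 v - e2 v).
by do ![apply: recursiveB] => //; exact: recursive_const.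
Qed.

Lemma recursive_eq n e1 e2 : recursive n e1 -> recursive n e2 ->
  recursive n (fun v => nat_of_bool (e1 v == e2 v)).
Proof.
move=> e1P e2P.
apply: (@recursive_ext _ (fun v => (e1 v <= e2 v) * (e2 v <= e1 v))).
  by move=> v _; rewrite eqn_leq mulnb.
by apply: recursiveM; exact: recursive_leq.
Qed.

Lemma recursive_nth_const (s : seq nat) n e :
  recursive n e -> recursive n (fun v => nth 0 s (e v)).
Proof.
apply: recursive_comp1; elim: s => [|x s IHs].
  by apply: recursive_ext (recursive0 _) => v _; rewrite nth_nil.
apply: (@recursive_ext _ (fun v =>
    if nth 0 v 0 == 0 then x else nth 0 s (nth 0 v 0).-1)).
  by move=> v _; case: (nth 0 v 0).
have v0 := @recursive_nth 1 0 isT.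
apply: recursive_if; first exact: recursive_eq (recursive0 _).
  exact: recursive_const.
exact: recursive_comp1 IHs (recursive_pred v0).
Qed.

Lemma recursive_divn K n e :
  recursive n e -> recursive n (fun v => e v %/ K).
Proof.
case: (posnP K) => [-> _|K_gt0].
  by apply: recursive_ext (recursive0 n) => v _; rewrite divn0.
apply: (recursive_comp1 (h := divn^~ K)).
(* The quotient of [k] is updated by counting: it grows at [k.+1] exactly when [q.+1 * K] has been
   reached. *)
apply: (@recursive_ext _ (fun v =>
    iteri (nth 0 v 0) (fun k q => q + (q.+1 * K <= k.+1)) 0)).
  move=> v _; elim: (nth 0 v 0) => [|k /= ->]; first by rewrite div0n.
  rewrite -leq_divRL // divnS // addnC.
  by case: (K %| k.+1); rewrite ?add1n ?add0n ?ltnSn ?ltnn.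
apply: (@recursive_iteri _ (fun k q _ => q + (q.+1 * K <= k.+1))).
- exact: recursive_nth.
- exact: recursive0.
have r0 := @recursive_nth 3 0 isT; have r1 := @recursive_nth 3 1 isT.
apply: recursiveD => //; apply: recursive_leq; last exact: recursiveS.
by apply: recursiveM; [exact: recursiveS|exact: recursive_const].
Qed.

Lemma recursive_modn K n e :
  recursive n e -> recursive n (fun v => e v %% K).
Proof.
move=> eP; apply: (@recursive_ext _ (fun v => e v - e v %/ K * K)).
  by move=> v _; rewrite {1}(divn_eq (e v) K) addKn.
apply: recursiveB => //; apply: recursiveM; last exact: recursive_const.
exact: recursive_divn.
Qed.

(** * Integer square roots and a pairing of natural numbers *)

Definition sqrtn k := iteri k (fun i r => r + (r.+1 ^ 2 <= i.+1)) 0.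

Lemma sqrtnP k : (sqrtn k) ^ 2 <= k < (sqrtn k).+1 ^ 2.
Proof.
elim: k => [|k] //; rewrite /sqrtn /= -/(sqrtn k) => /andP[le_rk lt_kr].
rewrite -/(sqrtn k).
have [le_r1k|lt_kr1] := leqP ((sqrtn k).+1 ^ 2) k.+1; last first.
  by rewrite addn0 lt_kr1 (leq_trans le_rk).
by rewrite addn1 le_r1k (leq_ltn_trans lt_kr) // ltn_exp2r.
Qed.

(** The value lies between (a + b)^2 and (a + b + 1)^2, the upper bound being strict, so an integer
    square root recovers a + b and then both components. Not every number is a pair, but the
    projections are total. *)
Definition npair a b := (a + b) ^ 2 + a.
Definition nfst k := k - sqrtn k ^ 2.
Definition nsnd k := sqrtn k - nfst k.

Lemma sqrtn_npair a b : sqrtn (npair a b) = a + b.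
Proof.
have /andP[le_r lt_r] := sqrtnP (npair a b); apply/eqP.
rewrite eqn_leq -ltnS -[X in _ && X]ltnS.
rewrite -(@ltn_exp2r _ _ 2) // -[X in _ && X](@ltn_exp2r _ _ 2) //.
rewrite (leq_ltn_trans le_r) /= ?(leq_ltn_trans _ lt_r) ?leq_addr //.
by rewrite /npair; nia.
Qed.

Lemma nfst_pair a b : nfst (npair a b) = a.
Proof. by rewrite /nfst sqrtn_npair addKn. Qed.

Lemma nsnd_pair a b : nsnd (npair a b) = b.
Proof. by rewrite /nsnd nfst_pair sqrtn_npair addKn. Qed.

Lemma recursive_sqrtn n e : recursive n e -> recursive n (fun v => sqrtn (e v)).
Proof.
move=> eP; apply: (@recursive_iteri _ (fun i r _ => r + (r.+1 ^ 2 <= i.+1))).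
- exact: eP.
- exact: recursive0.
have r0 := @recursive_nth n.+2 0 isT; have r1 := @recursive_nth n.+2 1 isT.
apply: recursiveD => //; apply: recursive_leq; last exact: recursiveS.
by apply: recursiveM; exact: recursiveS.
Qed.

Lemma recursive_nfst n e : recursive n e -> recursive n (fun v => nfst (e v)).
Proof.
move=> eP; apply: recursiveB => //.
by apply: recursiveM; exact: recursive_sqrtn.
Qed.

Lemma recursive_nsnd n e : recursive n e -> recursive n (fun v => nsnd (e v)).
Proof.
by move=> eP; apply: recursiveB; [exact: recursive_sqrtn|exact: recursive_nfst].
Qed.

Lemma recursive_iter n (F : nat -> nat) et e0 :
  recursive 1 (fun v => F (nth 0 v 0)) -> recursive n et -> recursive n e0 ->
  recursive n (fun v => iter (et v) F (e0 v)).
Proof.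
move=> FP etP e0P.
apply: (@recursive_ext _ (fun v => iteri (et v) (fun _ => F) (e0 v))).
  by move=> v _; elim: (et v) => //= k ->.
apply: (@recursive_iteri _ (fun _ z _ => F z)) => //.
exact: recursive_comp1 FP (recursive_nth _).
Qed.

Lemma recursive_all n (I : Type) (b : I -> seq nat -> bool) (r : seq I) :
  (forall i, recursive n (fun v => nat_of_bool (b i v))) ->
  recursive n (fun v => nat_of_bool (all (b^~ v) r)).
Proof.
move=> bP; elim: r => [|i r IHr] /=; first exact: recursive_const.
apply: recursive_ext (recursiveM (bP i) IHr) => v _; exact: mulnb.
Qed.

(* Here r k = 0 stands for a value that is not known yet and r k = y.+1 for the
   value y. The result is k.+2 if the search found the root k, 1 if it met an
   unknown value first, and 0 if it found no root below j. *)
Definition root_search (r : nat -> nat) j := iteri j (fun k z =>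
  if z == 0 then if r k == 0 then 1 else if r k == 1 then k.+2 else 0 else z) 0.

Lemma root_searchP r j k : root_search r j = k.+2 <->
  [/\ k < j, r k = 1 & forall i, i < k -> 1 < r i].
Proof.
(* The induction also needs the case where the search is still empty-handed: all values so far are
   known and nonzero. *)
suff [_ //] : (root_search r j = 0 <-> forall i, i < j -> 1 < r i) /\
  forall k, root_search r j = k.+2 <->
    [/\ k < j, r k = 1 & forall i, i < k -> 1 < r i].
elim: j => {k} [|j [IH0 IHk]]; first by split=> // k; split=> // -[].
rewrite /root_search /= -/(root_search r j).
split=> [|k]; case: eqP => [z0|nz].
- have /IH0 gt1 := z0; split=> [|gt1'].
    case r0: (r j) => [|[|x]] //= _ i; rewrite ltnS leq_eqVlt.
    by case/predU1P=> [->|/gt1 //]; rewrite r0.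
  by have := gt1' j (ltnSn j); case: (r j) => [|[]].
- split=> // gt1; case: nz; apply/IH0 => i lt_ij; exact/gt1/ltnW.
- have /IH0 gt1 := z0; case r0: (r j) => [|[|x]] /=.
  + split=> // -[]; rewrite ltnS leq_eqVlt => /predU1P[->|lt_kj rk _].
      by rewrite r0.
    by have := gt1 _ lt_kj; rewrite rk.
  + split=> [[<-] //|[]]; rewrite ltnS leq_eqVlt.
    by case/predU1P=> [->|/gt1/[swap]->].
  + split=> // -[]; rewrite ltnS leq_eqVlt => /predU1P[->|/gt1/[swap]->] //.
    by rewrite r0.
- rewrite IHk; split=> [[lt_kj rk gt1]|[]]; first by split; rewrite // ltnW.
  rewrite ltnS leq_eqVlt => /predU1P[->|lt_kj rk gt1 //] rj gt1.
  by case: nz; apply/IH0.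
Qed.

(* e (t :: v) is 0 as long as t steps do not suffice to evaluate f at v, and
   y.+1 once the value y has been found. *)
Lemma step_evaluation n (f : recfun n) : exists e,
  [/\ recursive n.+1 e,
      forall (v : n.-tuple nat) s t y, s <= t ->
        e (s :: v) = y.+1 -> e (t :: v) = y.+1 &
      forall (v : n.-tuple nat) y,
        computes f v y <-> exists t, e (t :: v) = y.+1].
Proof.
elim: f => {n} [n||n i|k n f [ef [efR efM efP]] g gP
  |n f [ef [efR efM efP]] g [eg [egR egM egP]]|n f [ef [efR efM efP]]].
- exists (fun=> 1); split=> [|//|v y /=]; first exact: recursive_const.
  by split=> [->|[_ [<-]]]; [exists 0|].
- exists (fun v => (nth 0 v 1).+2); split=> [|//|v y /=].
    exact/recursiveS/recursiveS/recursive_nth.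
  rewrite (_ : nth 0 v 0 = thead v); last by rewrite /thead (tnth_nth 0).
  by split=> [->|[_ [<-]]]; [exists 0|].
- exists (fun v => (nth 0 v i.+1).+1); split=> [|//|v y /=].
    by apply/recursiveS/recursive_nth; rewrite ltnS.
  by rewrite (tnth_nth 0); split=> [->|[_ [<-]]]; [exists 0|].
- have [e eP] := choice gP.
  have eR i : recursive n.+1 (e i) by have [] := eP i.
  have eM i := let: And3 _ H _ := eP i in H.
  have eC i := let: And3 _ _ H := eP i in H.
  (* A component that is still unknown contributes a spurious 0 to [u]; the test on all components
     guards against it. *)
  have [u uE] : exists u : seq nat -> k.-tuple nat,
      forall s, u s = [tuple (e i s).-1 | i < k].
    by eexists => s; exact: erefl.
  exists (fun s => if all (fun i => 0 < e i s) (enum 'I_k)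
                   then ef (nth 0 s 0 :: u s) else 0); split.
  + apply: recursive_if; last exact: recursive0.
      by apply: recursive_all => i; apply: recursive_leq => //;
        exact: recursive_const.
    pose hs := (fun s => nth 0 s 0) ::
      [seq (fun s => (e i s).-1) | i <- enum 'I_k].
    have szhs : size hs = k.+1 by rewrite /= size_map size_enum_ord.
    apply: (@recursive_ext _ (fun s => ef [seq h s | h <- hs])) => [s _|].
      by rewrite uE /= -map_comp.
    apply: recursive_comp; rewrite szhs // => -[_|i lt_ik].
      exact: recursive_nth.
    rewrite /hs /= (nth_map (Ordinal (lt_ik : i < k))) ?size_enum_ord //.
    exact: recursive_pred.
  + move=> v s t y le_st; case: ifP => // /allP e_gt0 /=.
    have est i : e i (t :: v) = e i (s :: v).
      have := e_gt0 i (mem_enum _ _).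
      by case eis: (e i (s :: v)) => [//|z] _; exact: eM le_st eis.
    rewrite (eq_all (a2 := fun i => 0 < e i (s :: v))) => [|i]; last by rewrite est.
    have -> : u (t :: v) = u (s :: v) by rewrite !uE; apply: eq_mktuple => i; rewrite est.
    by case: allP => // _; exact: efM.
  + move=> v y /=; split=> [[w gw /efP[t0 ft0]]|[t]].
      have [T TP] := choice (fun i => (eC i _ _).1 (gw i)).
      pose t := maxn t0 (\max_i T i); exists t.
      have et i : e i (t :: v) = (tnth w i).+1.
        by apply: eM (TP i); rewrite leq_max leq_bigmax orbT.
      rewrite (eq_all (a2 := xpredT)) => [|i]; last by rewrite et.
      rewrite all_predT; have -> : u (t :: v) = w.
        by apply: eq_from_tnth => i; rewrite uE tnth_mktuple et.
      by apply: efM ft0; exact: leq_maxl.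
    case: ifP => // /allP e_gt0 fy; exists (u (t :: v)).
      move=> i; rewrite uE tnth_mktuple; apply/eC; exists t.
      by rewrite prednK // e_gt0 // mem_enum.
    by apply/efP; exists t.
(* Known values are shifted by one: an unknown value keeps [acc] at 0 from then on, and a known one
   is passed on as [z.-1]. *)
- pose acc t x (p : seq nat) := iteri x
    (fun k z => if z == 0 then 0 else eg [:: t, k, z.-1 & p]) (ef (t :: p)).
  exists (fun s => acc (nth 0 s 0) (nth 0 s 1) (drop 2 s)).
  have accP (p : n.-tuple nat) s t x y : s <= t ->
      acc s x p = y.+1 -> acc t x p = y.+1.
    move=> le_st; elim: x y => [|x IHx] y; first exact: efM.
    rewrite /acc /= -!/(acc _ _ _); case accs: (acc s x p) => [//|z].
    by rewrite (IHx _ accs); exact: (egM (cons_tuple x (cons_tuple z p))).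
  split.
  + apply: (@recursive_iteri _ (fun k z v => if z == 0 then 0 else
        eg [:: nth 0 v 0, k, z.-1 & drop 2 v])).
    * exact: recursive_nth.
    * apply: (@recursive_comp_drop n 2 _ [:: nth 0 ^~ 0]) => // -[] // _.
      exact: recursive_nth.
    have r1 := @recursive_nth n.+4 1 isT.
    apply: recursive_if; first exact: recursive_eq (recursive0 _).
      exact: recursive0.
    have := @recursive_comp_drop n 4 eg [:: fun v => nth 0 v 2;
      nth 0 ^~ 0; fun v => (nth 0 v 1).-1] egR.
    case=> [|f0 f0P]; last first.
      exists f0 => v y; rewrite f0P /=.
      by rewrite -!drop1 !drop_drop nth_drop.
    by move=> [|[|[]]] //= _; [exact: recursive_nth..|exact: recursive_pred].
  + by move=> v s t y le_st; case/tupleP: v => x p /=; rewrite drop0; exact: accP.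
  + case/tupleP=> x p y /=; rewrite theadE drop0.
    have -> : behead_tuple (cons_tuple x p) = p by exact: val_inj.
    elim: x y => [|x IHx] y; first exact: efP.
    split=> [[z /IHx[s accs] /egP[t gt]]|[t]].
      exists (maxn s t); rewrite /acc /= -/(acc _ _ _).
      rewrite (accP _ _ _ _ _ (leq_maxl s t) accs) /=.
      exact: (egM (cons_tuple x (cons_tuple z p))) (leq_maxr _ _) gt.
    rewrite /acc /= -/(acc _ _ _); case acct: (acc t x p) => [//|z] /= gt.
    by exists z; [apply/IHx; exists t|apply/egP; exists t].
(* The time also bounds the range of the search. The predecessor turns a root found, [k.+2], into
   the known value [k.+1], and both kinds of failure, 0 and 1, into the unknown 0. *)
- exists (fun s => (root_search (fun k =>
    ef [:: nth 0 s 0, k & drop 1 s]) (nth 0 s 0)).-1); split.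
  + apply: recursive_pred.
    apply: (@recursive_iteri _ (fun k z s => if z == 0 then
      let r := ef [:: nth 0 s 0, k & drop 1 s] in
      if r == 0 then 1 else if r == 1 then k.+2 else 0 else z)).
    * exact: recursive_nth.
    * exact: recursive0.
    have r0 := @recursive_nth n.+3 0 isT; have r1 := @recursive_nth n.+3 1 isT.
    have fR : recursive n.+3 (fun s => ef [:: nth 0 (behead (behead s)) 0,
        nth 0 s 0 & drop 1 (behead (behead s))]).
      have := @recursive_comp_drop n 3 ef [:: fun v => nth 0 v 2; nth 0 ^~ 0] efR.
      case=> [|f0 f0P]; last first.
        by exists f0 => v y; rewrite f0P /= -!drop1 !drop_drop nth_drop.
      by move=> [|[]] //= _; exact: recursive_nth.
    apply: recursive_if => //; first exact: recursive_eq (recursive0 _).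
    apply: recursive_if; first exact: recursive_eq (recursive0 _).
      exact: recursive_const.
    apply: recursive_if; last exact: recursive0.
      exact: recursive_eq (recursive_const _ _).
    by do 2 apply: recursiveS.
  + move=> v s t y le_st /=; rewrite !drop0.
    case rs: (root_search _ s) => [//|[//|z]] [<-].
    move/root_searchP: rs => [lt_zs fz gt1].
    suff -> : root_search (fun k => ef [:: t, k & v]) t = z.+2 by [].
    apply/root_searchP; split; first exact: leq_trans lt_zs le_st.
      exact: (efM (cons_tuple z v)) le_st fz.
    move=> i /gt1; case fi: (ef _) => [//|[//|x]] _.
    by rewrite (efM (cons_tuple i v) _ _ _ le_st fi).
  + move=> v y /=; split=> [[/efP[t0 ft0] lty]|[t]].
      have {}lty z : exists t, z < y -> 1 < ef [:: t, z & v].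
        case: (ltnP z y) => [/lty[k /efP[t ft]]|_]; last by exists 0.
        by exists t; rewrite ft.
      have [T TP] := choice lty.
      (* Besides allowing the evaluations at [y] and at all smaller arguments, [t] must exceed [y]
         for the search to reach it. *)
      pose t := maxn y.+1 (maxn t0 (\max_(z < y) T z)); exists t.
      suff -> : root_search (fun k => ef [:: t, k & drop 0 v]) t = y.+2 by [].
      rewrite drop0; apply/root_searchP; split; first by rewrite leq_maxl.
        by apply: (efM (cons_tuple y v)) ft0; rewrite !leq_max leqnn orbT.
      move=> z lt_zy; have := TP z lt_zy.
      case fz: (ef _) => [//|[//|x]] _.
      rewrite (efM (cons_tuple z v) _ t _ _ fz) // !leq_max.
      by rewrite (leq_bigmax (Ordinal lt_zy) : T z <= _) !orbT.
    rewrite drop0; case rs: (root_search _ t) => [//|[//|z]] [<-].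
    move/root_searchP: rs => [lt_zs fz gt1].
    split=> [|i /gt1]; first by apply/efP; exists t.
    case fi: (ef _) => [//|[//|x]] _; exists x; apply/efP; by exists t.
Qed.

(** * Operations on codes of words *)

(** Unbounded search for an output coded as [y.+1]: minimization is applied to [1 - e], which
    vanishes where [e] is positive, and the predecessor of [e] at the [k] found is returned. *)
Lemma recursive_search e : recursive 2 e -> exists f : recfun 1,
  (forall x y, computes f [tuple x] y -> exists k, e [:: k; x] = y.+1) /\
  (forall x k, 0 < e [:: k; x] -> exists y, computes f [tuple x] y).
Proof.
move=> eR.
have [g gP] : recursive 2 (fun v => 1 - e v).
  by apply: recursiveB => //; exact: recursive_const.
have [p pP] := recursive_pred eR.
exists (RComp p (fun i : 'I_2 => if i == ord0 then RMu g else RProj ord0)).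
split=> [x y /= [u uP /pP ->]|x k ek].
  have [/gP /= g0 _] := uP ord0.
  have /= := uP ord_max; rewrite (tnth_nth 0) /= => u1; exists (tnth u ord0).
  have uE : tval u = [:: tnth u ord0; x].
    by case/tupleP: u u1 {uP g0} => a /tupleP[b w]; rewrite (tuple0 w) !(tnth_nth 0) /= => ->.
  by rewrite uE; move/eqP: g0; rewrite eq_sym subn_eq0; case: (e _).
have ex : exists k, 0 < e [:: k; x] by exists k.
case: (ex_minnP ex) => {ek k ex} k ek kmin.
exists (e [:: k; x]).-1 => /=; exists [tuple k; x] => [i|]; last exact/pP.
case: i => [[|[|//]]] lt_i /=.
  split=> [|z lt_zk]; first by apply/gP => /=; case: (e _) ek.
  exists 0; apply/gP => /=; have := contraNN (kmin z); rewrite -ltnNge => /(_ lt_zk).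
  by case: (e _).
by rewrite !(tnth_nth 0).
Qed.

Section Codes.
Variable m : nat.

Definition code_behead c := c.-1 %/ m.*2.
Definition code_head c := c.-1 %% m.*2.

(* The digits are met from the last to the first, and the code bounds the
   number of them. *)
Definition code_foldr (s : nat -> nat -> nat) z c := iteri c (fun k acc =>
  let c' := iter (c - k.+1) code_behead c in
  if c' == 0 then acc else s (code_head c') acc) z.

Lemma letter_code_lt (a : letter m) : letter_code a < m.*2.
Proof. by case: a => i b; have := ltn_ord i; rewrite /letter_code /=; lia. Qed.

Lemma code_behead_cons (a : letter m) w :
  code_behead (word_code (a :: w)) = word_code w.
Proof.
have lt_a := letter_code_lt a; rewrite /code_behead /= mulnC addnC.
by rewrite divnMDl ?divn_small ?addn0 //; exact: leq_ltn_trans lt_a.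
Qed.

Lemma code_head_cons (a : letter m) w :
  code_head (word_code (a :: w)) = letter_code a.
Proof.
by rewrite /code_head /= mulnC addnC modnMDl modn_small ?letter_code_lt.
Qed.

Lemma iter_code_behead k (w : word m) :
  iter k code_behead (word_code w) = word_code (drop k w).
Proof.
elim: k w => [|k IHk] [|a w] //; rewrite iterSr ?code_behead_cons ?IHk //.
  by rewrite /code_behead /= div0n (IHk [::]).
Qed.

Lemma size_word_code (w : word m) : size w <= word_code w.
Proof. by elim: w => //= a w IHw; have := letter_code_lt a; nia. Qed.

Lemma code_foldrE s z (w : word m) : code_foldr s z (word_code w) =
  foldr (fun a acc => s (letter_code a) acc) z w.
Proof.
rewrite /code_foldr; set N := (X in iteri X); have leN : size w <= N.
  exact: size_word_code.
(* After [k] rounds the suffix starting at position [N - k] has been folded. Positions past the end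
   of the word give the code 0, which is skipped. *)
suff foldk k : k <= N -> iteri k (fun k acc =>
    let c' := iter (N - k.+1) code_behead N in
    if c' == 0 then acc else s (code_head c') acc) z =
    foldr (fun a acc => s (letter_code a) acc) z (drop (N - k) w).
  by rewrite foldk // subnn drop0.
elim: k => [_|k IHk lt_kN]; first by rewrite subn0 drop_oversize.
rewrite /= {}IHk ?(ltnW lt_kN) // iter_code_behead.
case: (ltnP (N - k.+1) (size w)) => [lt_w|le_w].
  have a0 : letter m by case: (w) lt_w.
  by rewrite (drop_nth a0 lt_w) -subSn // subSS code_head_cons /=.
by rewrite (drop_oversize le_w) /= drop_oversize // (leq_trans le_w) // leq_sub.
Qed.

Lemma recursive_code_foldr n s ez ec :
  recursive 2 (fun v => s (nth 0 v 0) (nth 0 v 1)) ->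
  recursive n ez -> recursive n ec ->
  recursive n (fun v => code_foldr s (ez v) (ec v)).
Proof.
move=> sR ezR ecR.
have headR k e : recursive k e -> recursive k (fun v => code_head (e v)).
  by move=> eR; apply: recursive_modn; exact: recursive_pred.
have beheadR k e : recursive k e -> recursive k (fun v => code_behead (e v)).
  by move=> eR; apply: recursive_divn; exact: recursive_pred.
apply: (@recursive_iteri _ (fun k acc v =>
  let c' := iter (ec v - k.+1) code_behead (ec v) in
  if c' == 0 then acc else s (code_head c') acc)) => //.
have r0 := @recursive_nth n.+2 0 isT; have r1 := @recursive_nth n.+2 1 isT.
have ec2R := recursive_behead2 ecR.
have c'R : recursive n.+2 (fun v => iter
    (ec (behead (behead v)) - (nth 0 v 0).+1) code_behead
    (ec (behead (behead v)))).
  apply: recursive_iter => //; first exact/beheadR/recursive_nth.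
  by apply: recursiveB => //; exact: recursiveS.
apply: recursive_if => //; first exact: recursive_eq (recursive0 _).
by apply: recursive_comp2 => //; exact: headR.
Qed.

Definition code_cat c1 c2 := code_foldr (fun d c => (d + m.*2 * c).+1) c2 c1.

Lemma code_catE (u v : word m) :
  code_cat (word_code u) (word_code v) = word_code (u ++ v).
Proof. by rewrite /code_cat code_foldrE /word_code foldr_cat. Qed.

Lemma recursive_code_cat n e1 e2 : recursive n e1 -> recursive n e2 ->
  recursive n (fun v => code_cat (e1 v) (e2 v)).
Proof.
move=> e1R e2R; apply: recursive_code_foldr => //.
apply/recursiveS/recursiveD; first exact: recursive_nth.
by apply: recursiveM; [exact: recursive_const|exact: recursive_nth].
Qed.

(** Bijectivity of the numeration: Euclidean division of the predecessor by 2m gives the code of the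
    tail and a digit, whose half and parity are the two components of the first letter. Hence any
    number may serve as a context in a rewriting step. *)
Lemma word_code_surj c : 0 < m -> exists w : word m, word_code w = c.
Proof.
move=> m_gt0; elim/ltn_ind: c => -[_|c IHc]; first by exists [::].
have m2_gt0 : 0 < m.*2 by rewrite double_gt0.
have [w wE] : exists w : word m, word_code w = c %/ m.*2.
  by apply: IHc; rewrite ltnS leq_div.
have lt_i : (c %% m.*2)./2 < m by have := ltn_pmod c m2_gt0; lia.
exists ((Ordinal lt_i, odd (c %% m.*2)) :: w) => /=.
rewrite wE /letter_code /= [X in (X + _).+1]addnC odd_double_half.
by rewrite addnC mulnC -divn_eq.
Qed.

End Codes.

(** * Rewriting modulo the kernel *)

(** Any element of [L] may replace any other, so steps are reversible; once the empty word is in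
    [L], they include the insertion and the erasure of elements of [L]. *)
Inductive rewrites m (L : seq (word m)) (x : word m) : word m -> Prop :=
| RwRefl : rewrites L x x
| RwStep u v l l' : rewrites L x (u ++ l ++ v) -> l \in L -> l' \in L ->
    rewrites L x (u ++ l' ++ v).

Section Rewrites.
Variables (m : nat) (L : seq (word m)).

Lemma rewrites_trans y x z :
  rewrites L x y -> rewrites L y z -> rewrites L x z.
Proof. by move=> xy; elim=> // u v l l' _ xu; exact: RwStep xu. Qed.

Lemma rewrites_step u v l l' : l \in L -> l' \in L ->
  rewrites L (u ++ l ++ v) (u ++ l' ++ v).
Proof. by apply: RwStep; exact: RwRefl. Qed.

Lemma rewrites_sym x y : rewrites L x y -> rewrites L y x.
Proof.
elim=> [|u v l l' _ ux lL l'L]; first exact: RwRefl.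
exact: rewrites_trans (rewrites_step _ _ l'L lL) ux.
Qed.

Lemma rewrites_ctx p s x y :
  rewrites L x y -> rewrites L (p ++ x ++ s) (p ++ y ++ s).
Proof.
elim=> [|u v l l' _ xu lL l'L]; first exact: RwRefl.
have := @RwStep m L (p ++ x ++ s) (p ++ u) (v ++ s) l l'.
by rewrite -!catA in xu *; apply.
Qed.

Lemma rewrites_cat x y x' y' : rewrites L x y -> rewrites L x' y' ->
  rewrites L (x ++ x') (y ++ y').
Proof.
move=> xy xy'; apply: rewrites_trans (rewrites_ctx [::] x' xy) _.
by have := rewrites_ctx y [::] xy'; rewrite !cats0.
Qed.

Lemma rewrites_erase l x y : [::] \in L -> l \in L ->
  rewrites L (x ++ l ++ y) (x ++ y).
Proof. by move=> nilL lL; exact: rewrites_step lL nilL. Qed.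

End Rewrites.

Section Kernel.
Variables (G : groupType) (m : nat) (phi : word m -> G).
Hypothesis phiP : choice_of_generators phi.

Lemma rewrites_sound L x y : {in L, forall l, phi l = 1%g} ->
  rewrites L x y -> phi y = phi x.
Proof.
move=> L1; elim=> // u v l l' _ <- /L1 l1 /L1 l'1.
by rewrite !(gens_cat phiP) l1 l'1.
Qed.

Definition subst n (s : letter n -> word m) (w : word n) : word m :=
  flatten (map s w).

Lemma subst_cat n (s : letter n -> word m) u v :
  subst s (u ++ v) = subst s u ++ subst s v.
Proof. by rewrite /subst map_cat flatten_cat. Qed.

Lemma subst_cons n (s : letter n -> word m) a v :
  subst s (a :: v) = s a ++ subst s v.
Proof. by []. Qed.

Lemma lift_letters n (psi : word n -> G) : choice_of_generators psi ->
  exists s : letter n -> word m, forall w, phi (subst s w) = psi w.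
Proof.
move=> psiP; have [s sP] := choice (fun a => gens_surj phiP (psi [:: a])).
exists s; elim=> [|a w IHw]; first by rewrite (gens_nil phiP) (gens_nil psiP).
by rewrite subst_cons (gens_cat phiP) sP IHw -(gens_cat psiP).
Qed.

End Kernel.

(* With substitutions s and t between the two sets of generators, the words
   a a^-1 and a^-1 t(s(a)) identify x with t(s(x)), which the translated
   relators reduce when it is trivial; the words t(b b^-1) make the inverses in
   a normal closure available. *)
Lemma kernel_rewrites (G : groupType) (m : nat) (phi : word m -> G) :
  finitely_presented G -> choice_of_generators phi ->
  exists2 L : seq (word m), [::] \in L &
    forall x y, phi x = phi y <-> rewrites L x y.
Proof.
move=> [n [psi [rels [psiP relsP]]]] phiP.
have [s sP] := lift_letters psiP phiP.
have [t tP] := lift_letters phiP psiP.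
pose L : seq (word m) := [::] ::
  [seq [:: a; letter_inv a] | a <- enum {: letter m}] ++
  [seq letter_inv a :: subst t (s a) | a <- enum {: letter m}] ++
  [seq subst t [:: b; letter_inv b] | b <- enum {: letter n}] ++
  [seq subst t r | r <- rels].
have phi_cons a w : phi (a :: w) = (phi [:: a] * phi w)%g.
  by rewrite -cat1s (gens_cat phiP).
have s_letter a : psi (s a) = phi [:: a].
  by rewrite -sP subst_cons cats0.
have L1 : {in L, forall l, phi l = 1%g}.
  move=> l; rewrite inE !mem_cat => /predU1P[->|]; first exact: gens_nil phiP.
  case/or4P=> /mapP[c cP ->].
  - by rewrite (phi_cons c) (gens_inv phiP) mulgV.
  - by rewrite phi_cons tP s_letter (gens_inv phiP) mulVg.
  - by rewrite tP -cat1s (gens_cat psiP) (gens_inv psiP) mulgV.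
  - by rewrite tP; apply/relsP/NclRel.
have nilL : [::] \in L by rewrite inE eqxx.
have invL a : [:: a; letter_inv a] \in L.
  by rewrite inE !mem_cat (map_f _ (mem_enum _ a)) ?orbT.
have stL a : letter_inv a :: subst t (s a) \in L.
  rewrite inE !mem_cat.
  by rewrite (map_f (fun a => letter_inv a :: subst t (s a)) (mem_enum _ a)) !orbT.
have tinvL b : subst t [:: b; letter_inv b] \in L.
  rewrite inE !mem_cat.
  by rewrite (map_f (fun b => subst t [:: b; letter_inv b]) (mem_enum _ b)) !orbT.
have relL r : r \in rels -> subst t r \in L.
  by move=> rP; rewrite inE !mem_cat (map_f (subst t) rP) !orbT.
have nil_of l : l \in L -> rewrites L l [::].
  by move=> lL; have := rewrites_erase [::] [::] nilL lL; rewrite !cats0.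
(* [t] need not send inverse letters to inverse words, so the cancellation uses the words t(b b^-1),
   from the innermost pair outwards. *)
have subst_inv u : rewrites L (subst t u ++ subst t (word_inv u)) [::].
  elim: u => [|a u IHu]; first exact: RwRefl.
  rewrite /word_inv /= rev_cons -cats1 subst_cat subst_cons -/(word_inv u).
  rewrite -catA [X in t a ++ X]catA.
  apply: rewrites_trans (rewrites_ctx _ _ IHu) _.
  exact: nil_of (tinvL a).
have insert_inv u v a :
    rewrites L (subst t (u ++ a :: letter_inv a :: v)) (subst t (u ++ v)).
  have := rewrites_erase (subst t u) (subst t v) nilL (tinvL a).
  by rewrite -!subst_cat.
have ncl w : normal_closure rels w -> rewrites L (subst t w) [::].
  elim=> {w} [r /relL/nil_of //||u v _ IHu _ IHv|u _ IHu|u v _ IHu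
    |u v a _ IH|u v a _ IH].
  - exact: RwRefl.
  - by rewrite subst_cat; exact: rewrites_cat IHu IHv.
  - apply: rewrites_trans (subst_inv u).
    have := rewrites_cat IHu (RwRefl L (subst t (word_inv u))).
    exact: rewrites_sym.
  - rewrite !subst_cat; apply: rewrites_trans (rewrites_ctx _ _ IHu) _.
    exact: subst_inv.
  - exact: rewrites_trans (insert_inv u v a) IH.
  - exact: rewrites_trans (rewrites_sym (insert_inv u v a)) IH.
(* For a letter a, both sides arise from a a^-1 t(s(a)): erasing the last two factors leaves a,
   erasing the first two leaves t(s(a)). *)
have letters x : rewrites L x (subst t (subst s x)).
  elim: x => [|a x IHx]; first exact: RwRefl.
  rewrite subst_cons subst_cat -cat1s; apply: rewrites_cat IHx.
  apply: rewrites_trans (rewrites_erase [::] (subst t (s a)) nilL (invL a)).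
  have := rewrites_erase [:: a] [::] nilL (stL a); rewrite !cats0.
  exact: rewrites_sym.
have triv x : phi x = 1%g -> rewrites L x [::].
  move=> x1; apply: rewrites_trans (letters x) _.
  by apply/ncl/relsP; rewrite sP.
exists L => // x y; split=> [xy|/(rewrites_sound phiP L1) //].
(* With [w] representing the common inverse, y w x can be reduced both to y and to x. *)
have [w wP] := gens_surj phiP (phi x)^-1%g.
have wx : rewrites L (w ++ x) [::].
  by apply: triv; rewrite (gens_cat phiP) wP mulVg.
have yw : rewrites L (y ++ w) [::].
  by apply: triv; rewrite (gens_cat phiP) wP -xy mulgV.
have := rewrites_cat (RwRefl L y) wx; rewrite cats0 => ywx.
apply: rewrites_trans ywx; rewrite catA.
exact: rewrites_cat (rewrites_sym yw) (RwRefl L x).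
Qed.

Lemma letter_code_inj m : injective (@letter_code m).
Proof.
move=> a b ab; have : word_code [:: a] = word_code [:: b] by rewrite /= ab.
by move/word_code_inj => -[].
Qed.

(** * Substitution as a recursive function on codes *)

Section Substitution.
Variables (m n : nat) (s : letter n -> word m).

(** A finite table indexed by letter codes makes the substitution recursive for an arbitrary [s],
    which is obtained by choice. *)
Definition letter_images := mkseq (fun i =>
  if [pick a : letter n | letter_code a == i] is Some a
  then word_code (s a) else 0) n.*2.

Definition code_subst c :=
  code_foldr n (fun d acc => code_cat m (nth 0 letter_images d) acc) 0 c.

Lemma code_substE w : code_subst (word_code w) = word_code (subst s w).
Proof.
rewrite /code_subst code_foldrE; elim: w => //= a w ->.
rewrite subst_cons -code_catE nth_mkseq ?letter_code_lt //.
case: pickP => [b /eqP/letter_code_inj -> //|/(_ a)].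
by rewrite eqxx.
Qed.

Lemma recursive_code_subst k e :
  recursive k e -> recursive k (fun v => code_subst (e v)).
Proof.
move=> eR; apply: recursive_code_foldr => //; last exact: recursive0.
apply: recursive_code_cat; last exact: recursive_nth.
by apply: recursive_nth_const; exact: recursive_nth.
Qed.

End Substitution.

(** * Rewriting sequences as computations on codes *)

Section RewritingCodes.
Variables (m : nat) (L : seq (word m)).
Hypotheses (m_gt0 : 0 < m) (nilL : [::] \in L).

Let Lc i := nth 0 (map (@word_code m) L) i.

(* p codes (u, (v, (i, j))): rewrite u l_i v to u l_j v. *)
Definition code_step x p :=
  if x == code_cat m (nfst p) (code_cat m (Lc (nfst (nsnd (nsnd p))))
            (nfst (nsnd p)))
  then code_cat m (nfst p) (code_cat m (Lc (nsnd (nsnd (nsnd p))))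
            (nfst (nsnd p)))
  else x.

(** [c] is a list of [k] step codes nested by [npair]; iterating [nsnd] gives access to the [i]-th
    one. *)
Definition code_run c k x := iteri k (fun i y =>
  code_step y (nfst (iter i nsnd c))) x.

Lemma recursive_code_run n ec ek ex :
  recursive n ec -> recursive n ek -> recursive n ex ->
  recursive n (fun v => code_run (ec v) (ek v) (ex v)).
Proof.
move=> ecR ekR exR.
apply: (@recursive_iteri _ (fun i y v =>
  code_step y (nfst (iter i nsnd (ec v))))) => //.
apply: (recursive_comp2 (h := code_step)); last first.
- apply/recursive_nfst/recursive_iter; last exact: recursive_behead2.
    exact/recursive_nsnd/recursive_nth.
  exact: recursive_nth.
- exact: recursive_nth.
have r0 := @recursive_nth 2 0 isT; have r1 := @recursive_nth 2 1 isT.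
have r2 := recursive_nsnd r1; have r3 := recursive_nsnd r2.
have r4 := recursive_nsnd r3.
have u := recursive_nfst r1; have v := recursive_nfst r2.
have i := recursive_nfst r3.
apply: recursive_if => //; first apply: recursive_eq => //.
all: apply: recursive_code_cat => //; apply: recursive_code_cat => //.
all: exact: recursive_nth_const.
Qed.

(** Every number is a harmless instruction: contexts always decode to words, an index beyond the
    list reads 0, the code of the empty word, which is in [L], and a step that does not apply leaves
    [x] unchanged. *)
Lemma code_step_sound x p :
  exists2 y, code_step (word_code x) p = word_code y & rewrites L x y.
Proof.
rewrite /code_step; have [u <-] := word_code_surj (nfst p) m_gt0.
have [v <-] := word_code_surj (nfst (nsnd p)) m_gt0.
have LcP i : exists2 l, l \in L & Lc i = word_code l.
  case: (ltnP i (size L)) => [lt_i|le_i].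
    by exists (nth [::] L i); [exact: mem_nth|rewrite /Lc (nth_map [::])].
  by exists [::] => //; rewrite /Lc nth_default ?size_map.
have [l lL ->] := LcP (nfst (nsnd (nsnd p))).
have [l' l'L ->] := LcP (nsnd (nsnd (nsnd p))).
rewrite !code_catE; case: eqP => [/word_code_inj ->|_].
  by exists (u ++ l' ++ v) => //; exact: rewrites_step.
by exists x => //; exact: RwRefl.
Qed.

Lemma code_run_sound c k x :
  exists2 y, code_run c k (word_code x) = word_code y & rewrites L x y.
Proof.
elim: k => [|k [y yE xy]]; first by exists x => //; exact: RwRefl.
rewrite /code_run /= -/(code_run _ _ _) yE.
have [y' -> yy'] := code_step_sound y (nfst (iter k nsnd c)).
by exists y' => //; exact: rewrites_trans yy'.
Qed.

Lemma code_step_complete u v l l' : l \in L -> l' \in L ->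
  exists p, code_step (word_code (u ++ l ++ v)) p = word_code (u ++ l' ++ v).
Proof.
move=> lL l'L; exists (npair (word_code u) (npair (word_code v)
  (npair (index l L) (index l' L)))).
rewrite /code_step !(nfst_pair, nsnd_pair) /Lc.
by rewrite !(nth_map [::]) ?index_mem // !nth_index // !code_catE eqxx.
Qed.

Lemma code_run_pair p c k x :
  code_run (npair p c) k.+1 x = code_run c k (code_step x p).
Proof.
elim: k => [|k IHk]; first by rewrite /code_run /= nfst_pair.
have -> : code_run (npair p c) k.+2 x = code_step
    (code_run (npair p c) k.+1 x) (nfst (iter k.+1 nsnd (npair p c))) by [].
by rewrite IHk iterSr nsnd_pair.
Qed.

Lemma code_run_complete x y : rewrites L x y ->
  exists c k, code_run c k (word_code x) = word_code y.
Proof.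
(* The derivation is reversed, so that each induction step adds an instruction at the front, where
   [npair] puts it. *)
move/rewrites_sym; elim=> [|u v l l' _ [c [k IH]] lL l'L].
  by exists 0, 0.
have [p pP] := code_step_complete u v l'L lL.
by exists (npair p c), k.+1; rewrite code_run_pair pP.
Qed.

End RewritingCodes.

(** * Return words in amenable groups *)

Import Order.TTheory GRing.Theory Num.Theory.
Import numFieldNormedType.Exports.

Section Amenable.
Local Open Scope classical_set_scope.
Local Open Scope ring_scope.

Lemma norm_bounded_fun (R : realType) (T : Type) (f : T -> R) (M : R) :
  (forall x, `|f x| <= M) -> bounded_fun f.
Proof.
move=> fM; exists M; split; first exact: num_real.
by move=> r /ltW leMr x _ /=; exact: le_trans (fM x) leMr.
Qed.

(** * The Green function and its logarithmic drift *)

Section ReturnWords.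
Variables (R : realType) (G : groupType) (m : nat) (phi : word m -> G).

Fixpoint word_count (k : nat) (x : G) : nat :=
  if k is k'.+1 then (\sum_(a : letter m) word_count k' ((phi [:: a])^-1 * x)%g)%N
  else (x == 1%g).

Hypothesis phiP : choice_of_generators phi.

Lemma phi_cons a w : phi (a :: w) = (phi [:: a] * phi w)%g.
Proof. by rewrite -cat1s (gens_cat phiP). Qed.

Lemma word_countE k x :
  word_count k x = (\sum_(w : k.-tuple (letter m)) (phi w == x))%N.
Proof.
elim: k x => [|k IHk] x /=.
  rewrite (bigD1 [tuple]) //= big1 => [|w /eqP[]]; last exact: tuple0.
  by rewrite addn0 (gens_nil phiP) eq_sym.
pose cons_pair p : k.+1.-tuple (letter m) := cons_tuple p.1 p.2.
rewrite (reindex cons_pair) /=; last first.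
  exists (fun w => (thead w, behead_tuple w)) => [[a w] _|w _].
    by congr pair; exact: val_inj.
  by rewrite [RHS]tuple_eta; exact: val_inj.
rewrite -(pair_big xpredT xpredT
  (fun a (w : k.-tuple (letter m)) => nat_of_bool (phi (a :: w) == x))) /=.
apply: eq_bigr => a _; rewrite IHk; apply: eq_bigr => w _.
by rewrite (phi_cons a w) -(inj_eq (mulgI (phi [:: a]))) mulVKg.
Qed.

Variable z : R.
Hypothesis z_gt0 : 0 < z.

Definition weight (x : G) : R ^nat := fun k => (word_count k x)%:R * z ^+ k.

Lemma weight_ge0 x k : 0 <= weight x k.
Proof. by rewrite mulr_ge0 // exprn_ge0 // ltW. Qed.

Lemma weight_series_nd x : nondecreasing_seq (series (weight x)).
Proof. by apply: nondecreasing_series => k _ _; exact: weight_ge0. Qed.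

(** Splitting off the first letter turns length [k.+1] into length [k], at the cost of one factor
    [z]; the nonnegative term of length 0 on the right is dropped. *)
Lemma sum_weight_step x n :
  \sum_(a : letter m) series (weight ((phi [:: a])^-1 * x)%g) n <=
  z^-1 * series (weight x) n.+1.
Proof.
rewrite /series /= big_nat_recl // mulrDr -[leLHS]add0r lerD //.
  by rewrite mulr_ge0 ?weight_ge0 // invr_ge0 ltW.
rewrite exchange_big mulr_sumr /=; apply: ler_sum => k _.
rewrite /weight /= natr_sum -mulr_suml exprS [leRHS]mulrCA.
by rewrite mulKf ?gt_eqF.
Qed.

Hypothesis cvg1 : cvgn (series (weight 1%g)).

Lemma is_cvg_weight_letter x a : cvgn (series (weight x)) ->
  cvgn (series (weight ((phi [:: a])^-1 * x)%g)).
Proof.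
move=> cvgx; apply: nondecreasing_is_cvgn; first exact: weight_series_nd.
exists (z^-1 * limn (series (weight x))) => _ [n _ <-].
apply: le_trans (_ : _ <= z^-1 * series (weight x) n.+1) _.
  apply: le_trans (sum_weight_step x n); rewrite (bigD1 a) //= lerDl.
  by apply: sumr_ge0 => b _; apply: sumr_ge0 => k _; exact: weight_ge0.
rewrite ler_pM2l ?invr_gt0 //.
exact: nondecreasing_cvgn_le (weight_series_nd x) cvgx _.
Qed.

(** Convergence spreads from 1 one letter at a time. As letters act by inverses on the left, [x] is
    written as the inverse of the value of a word that grows at its end. *)
Lemma is_cvg_weight x : cvgn (series (weight x)).
Proof.
have [w <-] : exists w, (phi w)^-1%g = x.
  by have [w wP] := gens_surj phiP x^-1%g; exists w; rewrite wP invgK.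
elim/last_ind: w => [|w a IHw]; first by rewrite (gens_nil phiP) invg1.
by rewrite -cats1 (gens_cat phiP) invgM; exact: is_cvg_weight_letter.
Qed.

Definition green (x : G) : R := limn (series (weight x)).

Lemma series_le_green x n : series (weight x) n <= green x.
Proof.
exact: nondecreasing_cvgn_le (weight_series_nd x) (@is_cvg_weight x) n.
Qed.

Lemma sum_green x :
  \sum_(a : letter m) green ((phi [:: a])^-1 * x)%g <= z^-1 * green x.
Proof.
have cvgL : (\sum_(a : letter m) series (weight ((phi [:: a])^-1 * x)%g) n)
    @[n --> \oo] --> \sum_(a : letter m) green ((phi [:: a])^-1 * x)%g.
  by apply: (cvg_big add_continuous) => a _; exact: is_cvg_weight.
rewrite -(cvg_lim _ cvgL) //; apply: limr_le; first exact: cvgP cvgL.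
apply: nearW => n; apply: le_trans (sum_weight_step x n) _.
by rewrite ler_pM2l ?invr_gt0 // series_le_green.
Qed.

(** A word representing [x] makes the term of its own length positive. *)
Lemma green_gt0 x : 0 < green x.
Proof.
have [w wx] := gens_surj phiP x.
apply: lt_le_trans (series_le_green x (size w).+1).
rewrite /series /= big_nat_recr //= ltr_wpDl //.
  by apply: sumr_ge0 => k _; exact: weight_ge0.
rewrite mulr_gt0 ?exprn_gt0 // ltr0n word_countE.
by rewrite (bigD1 (in_tuple w)) //= wx eqxx.
Qed.

Lemma green_letter a x : green ((phi [:: a])^-1 * x)%g <= z^-1 * green x.
Proof.
apply: le_trans (sum_green x); rewrite (bigD1 a) //= lerDl.
by apply: sumr_ge0 => b _; exact/ltW/green_gt0.
Qed.

Definition drift a x : R := ln (green ((phi [:: a])^-1 * x)%g) - ln (green x).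

Lemma drift_inv a x : drift (letter_inv a) x = - drift a (phi [:: a] * x)%g.
Proof. by rewrite /drift (gens_inv phiP) invgK mulKg opprB. Qed.

Lemma drift_le a x : drift a x <= - ln z.
Proof.
rewrite /drift lerBlDr -lnV ?posrE // -lnM ?posrE ?invr_gt0 ?green_gt0 //.
by rewrite ler_ln ?posrE ?mulr_gt0 ?invr_gt0 ?green_gt0 // green_letter.
Qed.

(** By [drift_inv], the upper bound for the inverse letter is the lower bound for [a]. *)
Lemma drift_bounded a : bounded_fun (drift a).
Proof.
apply: (@norm_bounded_fun _ _ _ (- ln z)) => x.
rewrite ler_norml drift_le andbT lerNl -[x](mulKg (phi [:: a])^-1%g) invgK.
by rewrite -drift_inv drift_le.
Qed.

Lemma sum_drift x : \sum_(a : letter m) drift a x <= z^-1 - m.*2%:R.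
Proof.
have gx := green_gt0 x.
apply: le_trans (_ : _ <= \sum_(a : letter m)
    (green ((phi [:: a])^-1 * x)%g / green x - 1)) _.
  apply: ler_sum => a _; have ga := green_gt0 ((phi [:: a])^-1 * x)%g.
  rewrite /drift -ln_div ?posrE // -[X in ln X](addrNK 1) addrC le_ln1Dx //.
  by rewrite ltrBrDl subrr divr_gt0.
rewrite sumrB sumr_const card_prod card_ord card_bool muln2 lerD2r //.
by rewrite -mulr_suml ler_pdivrMr // sum_green.
Qed.

End ReturnWords.

Lemma bounded_fun_sum (R : realType) (T I : Type) (r : seq I)
    (f : I -> T -> R) :
  (forall i, bounded_fun (f i)) -> bounded_fun (fun x => \sum_(i <- r) f i x).
Proof.
move=> fB; elim: r => [|i r IHr].
  by apply: (@norm_bounded_fun _ _ _ 0) => x; rewrite big_nil normr0.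
rewrite (_ : (fun x => _) = f i \+ (fun x => \sum_(j <- r) f j x)).
  exact: bounded_funD (fB i) IHr.
by apply/funext => x; rewrite big_cons.
Qed.

Lemma amenable_divergence (R : realType) (G : groupType) (m : nat)
    (phi : word m -> G) (z : R) :
  amenable R G -> choice_of_generators phi -> 0 < z -> z^-1 < m.*2%:R ->
  ~ cvgn (series (fun k => (word_count phi k 1%g)%:R * z ^+ k)).
Proof.
move=> [mu [muL mu_ge0 mu1 mu_inv]] phiP z_gt0 lt_z cvg1.
pose d := drift phi z; have dB a : bounded_fun (d a) by exact: drift_bounded.
have cstB (c : R) : bounded_fun (fun _ : G => c).
  by apply: (@norm_bounded_fun _ _ _ `|c|).
(* The linearity axiom, taken with c = -1 and both functions zero, gives the value at 0; the rule
   for negatives follows. *)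
have mu0 : mu (fun=> 0) = 0.
  have := muL (-1) _ _ (cstB 0) (cstB 0); rewrite mulN1r addNr.
  by rewrite mulN1r addNr.
have muN f : bounded_fun f -> mu (fun x => - f x) = - mu f.
  move=> fB; have := muL (-1) _ _ fB (cstB 0); rewrite mulN1r mu0 addr0 => <-.
  by congr mu; apply/funext => x; rewrite mulN1r addr0.
have mu_sum (r : seq (letter m)) :
    mu (fun x => \sum_(a <- r) d a x) = \sum_(a <- r) mu (d a).
  elim: r => [|a r IHr].
    rewrite big_nil (_ : (fun x => \sum_(a <- [::]) _) = fun=> 0) //.
    by apply/funext => x; rewrite big_nil.
  rewrite big_cons -IHr -[mu (d a)]mul1r -muL //.
    by congr mu; apply/funext => x; rewrite big_cons mul1r.
  exact: bounded_fun_sum.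
have sum0 : \sum_(a : letter m) mu (d a) = 0.
  have letter_invK : involutive (@letter_inv m).
    by case=> i b; rewrite /letter_inv /= negbK.
  have muV a : mu (d (letter_inv a)) = - mu (d a).
    rewrite -(mu_inv (phi [:: a]) _ (dB a)) -muN.
      by congr mu; apply/funext => x; exact: drift_inv.
    have [M [_ dM]] := dB a; exists M; split; first exact: num_real.
    by move=> r /dM dr x _; exact: dr.
  apply/eqP; suff : \sum_a mu (d a) == - \sum_a mu (d a).
    by rewrite -addr_eq0 -mulr2n mulrn_eq0.
  apply/eqP; rewrite [LHS](reindex_inj (inv_inj letter_invK)) /= -sumrN.
  exact: eq_bigr.
(* The constant is written as a multiple of 1 to match the linearity axiom and the normalization of
   [mu]. *)
have f_ge0 x : 0 <= (z^-1 - m.*2%:R) * 1 + - \sum_(a : letter m) d a x.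
  by rewrite mulr1 subr_ge0; exact: sum_drift.
have /mu_ge0/(_ f_ge0) : bounded_fun (fun x => (z^-1 - m.*2%:R) * 1 +
    - \sum_(a : letter m) d a x).
  exact: (bounded_funD (cstB _) (bounded_funN (bounded_fun_sum _ dB))).
rewrite muL ?muN ?mu_sum ?sum0 ?mu1; last 3 first.
- exact: bounded_fun_sum.
- exact: cstB.
- exact: (bounded_funN (bounded_fun_sum _ dB)).
by rewrite oppr0 addr0 mulr1 subr_ge0 leNgt lt_z.
Qed.

(** * Exponentially generic sets meet every fiber *)

Lemma card_bseq_le (T : finType) n : (1 < #|T|)%N ->
  (#|{: n.-bseq T}| <= 2 * #|T| ^ n)%N.
Proof.
move=> T_gt1; rewrite card_bseq; elim: n => [|n IHn].
  by rewrite big_ord_recr big_ord0.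
rewrite big_ord_recr /=; apply: leq_trans (leq_add IHn (leqnn _)) _.
by rewrite expnS [leqRHS]mul2n -addnn leq_add2r leq_mul2r T_gt1 orbT.
Qed.

(** Prefixing [w] embeds the trivial words of length [k] into the complement of [D]. *)
Lemma word_count_compl (G : groupType) (m : nat) (phi : word m -> G)
    (D : set (word m)) (w : word m) k : choice_of_generators phi ->
  (forall x, phi x = phi w -> ~ D x) ->
  (word_count phi k 1%g +
   #|[pred v : (size w + k).-bseq (letter m) | (v : word m) \in D]| <=
   #|{: (size w + k).-bseq (letter m)}|)%N.
Proof.
move=> phiP wD; rewrite -(cardC [pred v : _.-bseq _ | (v : word m) \in D]).
rewrite addnC leq_add2l word_countE //.
have sz (u : k.-tuple (letter m)) : (size (w ++ u) <= size w + k)%N.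
  by rewrite size_cat size_tuple.
pose f u := Bseq (sz u).
have f_inj : injective f.
  move=> u u' /(congr1 val)/= /(congr1 (drop (size w))).
  by rewrite !drop_size_cat // => /val_inj.
have -> : (\sum_(u : k.-tuple (letter m)) (phi u == 1%g))%N =
    #|[set u : k.-tuple (letter m) | phi u == 1%g]%SET|.
  rewrite -sum1dep_card [RHS]big_mkcond; apply: eq_bigr => u _.
  by case: eqP.
rewrite -(card_imset _ f_inj); apply: subset_leq_card.
apply/fintype.subsetP => v /imsetP[u]; rewrite inE => /eqP u1 ->.
rewrite !inE /=; apply/negP; rewrite inE; apply: wD.
by rewrite (gens_cat phiP) u1 mulg1.
Qed.

Lemma generic_meets_fibers (R : realType) (G : groupType) (m : nat)
    (phi : word m -> G) (D : set (word m)) :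
  amenable R G -> (0 < m)%N -> choice_of_generators phi ->
  exponentially_generic R D -> forall w, exists2 x, D x & phi x = phi w.
Proof.
move=> amG m_gt0 phiP [alpha /andP[a_gt0 a_lt1] [N _ DN]] w.
apply: contrapT => wD; have {}wD x : phi x = phi w -> ~ D x.
  by move=> xw Dx; apply: wD; exists x.
(* [lam] lies strictly between [alpha] and 1: being below 1 it gives z^-1 = b lam < 2m, and being
   above [alpha] it makes the ratio [q] of the majorant less than 1. *)
pose b : R := m.*2%:R; pose lam := (1 + alpha) / 2.
have b_gt0 : 0 < b by rewrite ltr0n double_gt0.
have lam_gt0 : 0 < lam by rewrite /lam; lra.
pose z := (b * lam)^-1; pose q := alpha / lam.
have z_gt0 : 0 < z by rewrite invr_gt0 mulr_gt0.
have q_gt0 : 0 < q by rewrite divr_gt0.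
have z_lt : z^-1 < m.*2%:R.
  by rewrite invrK gtr_pMr // /lam; lra.
apply: (amenable_divergence amG phiP z_gt0 z_lt).
pose u k : R := (word_count phi k 1%g)%:R * z ^+ k.
have u_ge0 k : 0 <= u k by rewrite mulr_ge0 // exprn_ge0 // ltW.
(* The factor 2 bounds the number of words of length at most n by 2 b^n; the power accounts for the
   prefix [w]. *)
pose C0 := 2 * (alpha * b) ^+ size w.
have tail k : (N <= k)%N -> u k <= C0 * q ^+ k.
  move=> le_Nk; set n := (size w + k)%N.
  have /DN : (N <= n)%N by rewrite (leq_trans le_Nk) ?leq_addl.
  have := word_count_compl k phiP wD; rewrite -/n.
  set W := #|{: n.-bseq _}|; set d := #|_| => le_W.
  have W_le : (W <= 2 * m.*2 ^ n)%N.
    have := @card_bseq_le (letter m) n.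
    by rewrite card_prod card_ord card_bool muln2; apply; lia.
  have W_gt0 : (0 < W)%N by apply/card_gt0P; exists [bseq].
  move=> /(le_trans (ler_norm _)) dW.
  have cW : (word_count phi k 1%g)%:R <= alpha ^+ n * (2 * b ^+ n).
    apply: le_trans (_ : _ <= (1 - d%:R / W%:R) * W%:R) _.
      rewrite mulrBl mul1r divfK ?pnatr_eq0 -?lt0n // lerBrDr -natrD ler_nat.
      exact: le_W.
    apply: ler_pM => //.
    - rewrite subr_ge0 ler_pdivrMr ?ltr0n // mul1r ler_nat.
      exact: leq_trans (leq_addl _ _) le_W.
    - by rewrite -natrX -natrM ler_nat.
  have -> : C0 * q ^+ k = alpha ^+ n * (2 * b ^+ n) * z ^+ k.
    rewrite /C0 /q /z /n !(exprD, exprMn, exprVn); field.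
    by rewrite !expf_neq0 // gt_eqF // addr_gt0.
  by rewrite ler_pM2r // exprn_gt0.
(* Enlarging the constant absorbs the finitely many terms below [N], so that the geometric bound
   holds from the start. *)
pose C := C0 + \sum_(j < N) u j / q ^+ j.
have C0_ge0 : 0 <= C0 by rewrite mulr_ge0 // exprn_ge0 // mulr_ge0 // ltW.
have S_ge0 (P : pred 'I_N) : 0 <= \sum_(j < N | P j) u j / q ^+ j.
  by apply: sumr_ge0 => j _; rewrite divr_ge0 // exprn_ge0 // ltW.
apply: (@series_le_cvg _ u (geometric C q)) => // [k|k|].
- by rewrite /= mulr_ge0 ?addr_ge0 ?exprn_ge0 // ltW.
- rewrite /=; case: (ltnP k N) => [lt_kN|/tail le_k].
    rewrite -ler_pdivrMr ?exprn_gt0 // /C (bigD1 (Ordinal lt_kN)) //=.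
    by rewrite addrCA lerDl addr_ge0.
  apply: le_trans le_k _; rewrite ler_pM2r ?exprn_gt0 // lerDl.
  exact: S_ge0.
apply: is_cvg_geometric_series; rewrite ger0_norm ?ltW //.
by rewrite ltr_pdivrMr // mul1r /lam; lra.
Qed.

End Amenable.

(** * Solving the word problem by a parallel search *)

Theorem theorem2p3 (R : realType) (G : groupType) :
  finitely_presented G -> amenable R G -> unsolvable_word_problem G ->
  forall (m : nat) (phi : word m -> G),
    (2 <= m)%N -> choice_of_generators phi ->
    forall D : set (word m),
      exponentially_generic R D -> ~ word_problem_solvable_on phi D.
Proof.
move=> fpG amG [n [psi [psiP unsolvable]]] m phi m_ge2 phiP D genD [f [fP fD]].
have m_gt0 : 0 < m by exact: ltnW.
apply: unsolvable; have [L nilL LP] := kernel_rewrites fpG phiP.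
have [s sP] := lift_letters phiP psiP.
have [ev [evR _ evP]] := step_evaluation f.
(* The search variable codes (t, (k, c)): t steps of the partial algorithm on the word reached from
   the translated input by the first k rewriting instructions of c. A single unbounded search thus
   covers all runs on all equal words. *)
pose e (v : seq nat) := ev [:: nfst (nth 0 v 0);
  code_run L (nsnd (nsnd (nth 0 v 0))) (nfst (nsnd (nth 0 v 0)))
    (code_subst s (nth 0 v 1))].
have eR : recursive 2 e.
  have r0 := @recursive_nth 2 0 isT; have r1 := @recursive_nth 2 1 isT.
  have r2 := recursive_nsnd r0.
  have runR := recursive_code_run L (recursive_nsnd r2) (recursive_nfst r2)
    (recursive_code_subst s r1).
  apply: (@recursive_comp 2 ev [:: fun v => nfst (nth 0 v 0); _]) => //.
  by move=> [|[|//]] _ /=; [exact: recursive_nfst|exact: runR].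
have [g [g_sound g_halts]] := recursive_search eR.
(* An answer found is correct because rewriting and the substitution [s] preserve the value in [G].
   The search halts because some word of [D] has that value and can be reached by rewriting. *)
exists g; split=> [w y /g_sound[k]|w _]; rewrite -?sP.
  rewrite /e /= code_substE.
  have [x -> /LP wx] := code_run_sound m_gt0 nilL (nsnd (nsnd k))
    (nfst (nsnd k)) (subst s w).
  by move=> evx; rewrite wx; apply/fP/evP; exists (nfst k).
have [x Dx xw] := generic_meets_fibers amG m_gt0 phiP genD (subst s w).
have [y /evP[t ty]] := fD x Dx.
have [c [k ck]] := code_run_complete ((LP _ _).1 (esym xw)).
apply: (g_halts _ (npair t (npair k c))).
by rewrite /e /= !(nfst_pair, nsnd_pair) code_substE ck ty.
Qed.
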